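(* Let $\psi\in L^{1}(\mathbb{T})$ be a bounded integrable function and let $g\in\mathcal{C}(\overline{\mathbb{D}})$. Let $f=h_{1}+\overline{h_{2}}-G[g]\in\mathcal{F}_{g,\psi}(\mathbb{D})$, where $h_{1}$ and $h_{2}$ are analytic in $\mathbb{D}$. If there is a constant $C_{3}\in[1,2)$ such that for all $z_{1},z_{2}\in\mathbb{D}$, $$|f(z_{1})-f(z_{2})|\leq C_{3}|h_{1}(z_{1})-h_{1}(z_{2})|,$$ then $f$ is an elliptic mapping in $\mathbb{D}$.
   Context: $\mathbb{D}=\{z\in\mathbb{C}:|z|<1\}$ and $\mathbb{T}=\partial\mathbb{D}$. $\mathcal{C}(\overline{\mathbb{D}})$ is the set of continuous complex-valued functions on $\overline{\mathbb{D}}$, and $\mathcal{C}^m(\mathbb{D})$ the set of $m$-times continuously differentiable complex-valued functions on $\mathbb{D}$. $\mathcal{F}_{g,\psi}(\mathbb{D})=\{f\in\mathcal{C}^{2}(\mathbb{D}):\Delta f=g \text{ in }\mathbb{D}\text{ and } f=\psi\text{ in }\mathbb{T}\}$. The solution of this boundary value problem for the Poisson equation is given by $f=P[\psi]-G[g]$, where $$P[\psi](z)=\frac{1}{2\pi}\int_{0}^{2\pi}\frac{1-|z|^2}{|1-ze^{-it}|^2}\psi(e^{it})\,dt,\qquad G[g](z)=\frac{1}{2\pi}\int_{\mathbb{D}}\log\left|\frac{1-z\overline{w}}{z-w}\right|g(w)\,dA(w),$$ with $dA$ the Lebesgue measure on $\mathbb{D}$. For $f\in\mathcal{F}_{g,\psi}(\mathbb{D})$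 the function $f+G[g]$ is harmonic in $\mathbb{D}$, and hence has the form $h_1+\overline{h_2}$ with $h_1,h_2$ analytic in $\mathbb{D}$. For a complex-valued $\mathcal{C}^1$ function $f$ put $f_z=(f_x-if_y)/2$, $f_{\overline z}=(f_x+if_y)/2$, $\|D_f\|=|f_z|+|f_{\overline z}|$ and $J_f=|f_z|^2-|f_{\overline z}|^2$. A mapping $f\in\mathcal{C}^1(\mathbb{D})$ is an elliptic mapping if there are constants $K\ge1$ and $K'\ge0$ such that $\|D_f(z)\|^2\le KJ_f(z)+K'$ for all $z\in\mathbb{D}$. *)

(* Defs.v *)
From HB Require Import structures.
From mathcomp Require Import all_boot all_order all_algebra.
From mathcomp Require Import complex.
From mathcomp Require Import all_classical all_reals all_analysis.

Set Implicit Arguments.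
Unset Strict Implicit.
Unset Printing Implicit Defensive.

Import Order.TTheory GRing.Theory Num.Theory.
Import numFieldNormedType.Exports.

Local Open Scope classical_set_scope.
Local Open Scope ring_scope.
Local Open Scope complex_scope.

(* The norm `|z| of R[i] is itself an element of R[i]; this is the real-valued
   modulus. *)
Definition cabs {R : realType} (z : R[i]) : R := ComplexField.Normc.normc z.

Definition cis {R : realType} (t : R) : R[i] := cos t +i* sin t.

Definition disk (R : realType) : set R[i] := [set z | cabs z < 1].
Definition cdisk (R : realType) : set R[i] := [set z | cabs z <= 1].
Definition circle (R : realType) : set R[i] := [set z | cabs z = 1].

(* R[i]^o carries the topology and the R[i]-normed module structure. *)
Definition continuous_on {R : realType} (D : set R[i]) (f : R[i] -> R[i]) : Prop :=
  {within (D : set R[i]^o), continuous (f : R[i]^o -> R[i]^o)}.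

Definition analytic_on {R : realType} (D : set R[i]) (h : R[i] -> R[i]) : Prop :=
  forall z, D z -> derivable (h : R[i]^o -> R[i]^o) z 1.

(* Derivative of a complex-valued function of a real variable. *)
Definition cderivable {R : realType} (c : R -> R[i]) (t : R) : Prop :=
  derivable (fun s => complex.Re (c s)) t 1 /\ derivable (fun s => complex.Im (c s)) t 1.
Definition cderive {R : realType} (c : R -> R[i]) (t : R) : R[i] :=
  derive1 (fun s => complex.Re (c s)) t +i* derive1 (fun s => complex.Im (c s)) t.

(* Partial derivatives in the real coordinates of z = x + iy. *)
Definition derivable_x {R : realType} (f : R[i] -> R[i]) (z : R[i]) : Prop :=
  cderivable (fun x => f (x +i* complex.Im z)) (complex.Re z).
Definition derivable_y {R : realType} (f : R[i] -> R[i]) (z : R[i]) : Prop :=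
  cderivable (fun y => f (complex.Re z +i* y)) (complex.Im z).
Definition dx {R : realType} (f : R[i] -> R[i]) (z : R[i]) : R[i] :=
  cderive (fun x => f (x +i* complex.Im z)) (complex.Re z).
Definition dy {R : realType} (f : R[i] -> R[i]) (z : R[i]) : R[i] :=
  cderive (fun y => f (complex.Re z +i* y)) (complex.Im z).

(* For D open: all partial derivatives of order at most m exist and are
   continuous on D. *)
Fixpoint Cm {R : realType} (m : nat) (D : set R[i]) (f : R[i] -> R[i]) : Prop :=
  continuous_on D f /\
  match m with
  | 0 => True
  | m'.+1 => (forall z, D z -> derivable_x f z /\ derivable_y f z) /\
             Cm m' D (dx f) /\ Cm m' D (dy f)
  end.

Definition laplacian {R : realType} (f : R[i] -> R[i]) (z : R[i]) : R[i] :=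
  dx (dx f) z + dy (dy f) z.

Definition dz {R : realType} (f : R[i] -> R[i]) (z : R[i]) : R[i] :=
  (dx f z - 'i * dy f z) / 2.
Definition dzbar {R : realType} (f : R[i] -> R[i]) (z : R[i]) : R[i] :=
  (dx f z + 'i * dy f z) / 2.

Definition normD {R : realType} (f : R[i] -> R[i]) (z : R[i]) : R :=
  cabs (dz f z) + cabs (dzbar f z).
Definition jacobian {R : realType} (f : R[i] -> R[i]) (z : R[i]) : R :=
  cabs (dz f z) ^+ 2 - cabs (dzbar f z) ^+ 2.

Definition elliptic_mapping {R : realType} (f : R[i] -> R[i]) : Prop :=
  Cm 1 (@disk R) f /\
  exists K K' : R, [/\ 1 <= K, 0 <= K' &
    forall z, disk z -> normD f z ^+ 2 <= K * jacobian f z + K'].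

Definition cintegral {d : measure_display} {T : measurableType d} {R : realType}
    (mu : {measure set T -> \bar R}) (A : set T) (F : T -> R[i]) : R[i] :=
  (\int[mu]_(x in A) complex.Re (F x)) +i* (\int[mu]_(x in A) complex.Im (F x)).

Definition L1_circle {R : realType} (psi : R[i] -> R[i]) : Prop :=
  (@lebesgue_measure R).-integrable `[0, 2 * pi]
    (fun t => (complex.Re (psi (cis t)))%:E) /\
  (@lebesgue_measure R).-integrable `[0, 2 * pi]
    (fun t => (complex.Im (psi (cis t)))%:E).

Definition bounded_circle {R : realType} (psi : R[i] -> R[i]) : Prop :=
  exists M : R, forall z, circle z -> cabs (psi z) <= M.

Definition poisson {R : realType} (psi : R[i] -> R[i]) (z : R[i]) : R[i] :=
  ((2 * pi)^-1)%:C *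
  cintegral (@lebesgue_measure R) `[0, 2 * pi]
    (fun t => ((1 - cabs z ^+ 2) / cabs (1 - z * cis (- t)) ^+ 2)%:C *
              psi (cis t)).

(* The area integral runs over R * R with the product Lebesgue measure, (x, y)
   standing for w = x + iy.  The singular point w = z has measure zero. *)
Definition green {R : realType} (g : R[i] -> R[i]) (z : R[i]) : R[i] :=
  ((2 * pi)^-1)%:C *
  cintegral ((@lebesgue_measure R) \x (@lebesgue_measure R))%E
    [set p : R * R | disk (p.1 +i* p.2)]
    (fun p => let w := p.1 +i* p.2 in
      (ln (cabs ((1 - z * conjc w) / (z - w))))%:C * g w).

(* f = psi on the unit circle, in the sense of radial limits almost everywhere,
   since psi need not be continuous. *)
Definition boundary_values {R : realType} (f psi : R[i] -> R[i]) : Prop :=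
  {ae @lebesgue_measure R, forall t, `[0, 2 * pi]%classic t ->
     (f (r%:C * cis t) : R[i]^o) @[r --> 1^'-] --> (psi (cis t) : R[i]^o)}.

(* Radial limits almost everywhere do not determine f (the Poisson kernel has
   radial limit 0 at every point but one), so the boundary value problem is
   understood together with its solution formula f = P[psi] - G[g]. *)
Definition poisson_class {R : realType} (g psi f : R[i] -> R[i]) : Prop :=
  [/\ Cm 2 (@disk R) f,
      forall z, disk z -> laplacian f z = g z,
      boundary_values f psi &
      forall z, disk z -> f z = poisson psi z - green g z].

(* Main.v *)
Require Import Defs.
From HB Require Import structures.
From mathcomp Require Import all_boot all_order all_algebra.
From mathcomp Require Import complex.
From mathcomp Require Import all_classical all_reals all_analysis.
From mathcomp Require Import measurable_realfun.
From mathcomp Require Import ring lra.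

Set Implicit Arguments.
Unset Strict Implicit.
Unset Printing Implicit Defensive.

Import Order.TTheory GRing.Theory Num.Theory.
Import numFieldNormedType.Exports.

Local Open Scope classical_set_scope.
Local Open Scope ring_scope.
Local Open Scope complex_scope.

(** Two facts about the gradient of [f] give the quadratic inequality.

    First, letting [z2] tend to [z1] along a line in the hypothesis bounds every directional
    derivative of [f] at [z] by $C_3 |h_1'(z)|$. The derivative in the direction [u] is
    $u f_z + \bar u f_{\bar z}$, and a suitable direction makes its modulus equal to
    $|u| (|f_z| + |f_{\bar z}|)$; hence $\|D_f\| \le C_3 |h_1'|$ ([lipschitz_normD_le]). The
    directions of the axes alone would only control $|f_z|^2 + |f_{\bar z}|^2$, which is too
    weak for $C_3$ close to 2, so [f] has to be differentiated along all lines; this is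
    where continuity of the partial derivatives enters ([line_derivative_C1]).

    Second, $f_z - h_1'$ is the holomorphic derivative of $-G[g]$, and it is bounded because
    $G[g]$ is Lipschitz on the disk ([green_lipschitz], [dz_sub_analytic_le]). For the
    Lipschitz bound, split the kernel into $\log|1 - z\bar w| - \log|z - w|$. Each logarithm
    varies between $z$ and $z'$ by at most $|z - z'| (1/|z - w| + 1/|z' - w|)$, because
    $|\log a - \log b| \le |a - b| (1/a + 1/b)$ and $|1 - z\bar w| \ge |z - w|$ on the disk.
    It remains to see that $\int_D dA(w)/|z - w|$ is bounded uniformly in $z$. Here $1/|z - w|$
    is dominated by the series of $2^n$ times the indicator of the square of half-side
    $2/2^n$ centred at $z$, whose integrals form a geometric series.

    With $a = |f_z|$, $b = |f_{\bar z}|$ and $N$ the bound of the second step this yields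
    $a + b \le C_3 (a + N)$, and $C_3 < 2$ makes this an inequality
    $(a + b)^2 \le K (a^2 - b^2) + K'$ ([quadratic_absorption]). *)

(** * The real modulus of a complex number *)

Section Modulus.
Variable R : realType.
Implicit Types (x y : R) (z w : R[i]).

Lemma cabsE x y : cabs (x +i* y) = Num.sqrt (x ^+ 2 + y ^+ 2).
Proof. by []. Qed.

Lemma sqr_cabs z : cabs z ^+ 2 = complex.Re z ^+ 2 + complex.Im z ^+ 2.
Proof. by case: z => x y; rewrite cabsE sqr_sqrtr ?addr_ge0 ?sqr_ge0. Qed.

Lemma cabs_ge0 z : 0 <= cabs z.
Proof. by case: z => x y; exact: sqrtr_ge0. Qed.

Lemma cabs0 : cabs (0 : R[i]) = 0.
Proof. exact: ComplexField.Normc.normc0. Qed.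

Lemma cabs1 : cabs (1 : R[i]) = 1.
Proof. exact: ComplexField.Normc.normc1. Qed.

Lemma cabs_eq0 z : (cabs z == 0) = (z == 0).
Proof.
apply/eqP/eqP => [|->]; [exact: ComplexField.Normc.eq0_normc|exact: cabs0].
Qed.

Lemma cabsM z w : cabs (z * w) = cabs z * cabs w.
Proof. exact: ComplexField.Normc.normcM. Qed.

Lemma cabsV z : cabs z^-1 = (cabs z)^-1.
Proof. exact: ComplexField.Normc.normcV. Qed.

Lemma cabsN z : cabs (- z) = cabs z.
Proof. exact: normcN. Qed.

Lemma cabsD z w : cabs (z + w) <= cabs z + cabs w.
Proof. exact: le_normcD. Qed.

Lemma cabsBC z w : cabs (z - w) = cabs (w - z).
Proof. by rewrite -cabsN opprB. Qed.

Lemma cabsB z w : cabs (z - w) <= cabs z + cabs w.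
Proof. by rewrite -[cabs w]cabsN cabsD. Qed.

Lemma cabs_dist z w : `|cabs z - cabs w| <= cabs (z - w).
Proof.
have tri (a b : R[i]) : cabs a - cabs b <= cabs (a - b).
  by rewrite lerBlDr -{1}(subrK b a) cabsD.
by rewrite ler_norml tri andbT lerNl opprB cabsBC tri.
Qed.

Lemma cabs_real x : cabs x%:C = `|x|.
Proof. by rewrite (cabsE x 0) expr0n addr0 sqrtr_sqr. Qed.

Lemma cabsi : cabs ('i : R[i]) = 1.
Proof. by rewrite (cabsE 0 1) expr0n add0r expr1n sqrtr1. Qed.

Lemma cabs_conj z : cabs (conjc z) = cabs z.
Proof. by case: z => x y; rewrite (cabsE x (- y)) cabsE sqrrN. Qed.

Lemma normr_Re_le z : `|complex.Re z| <= cabs z.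
Proof.
by rewrite -ler_sqr ?nnegrE ?cabs_ge0// sqr_cabs real_normK ?num_real// lerDl
  sqr_ge0.
Qed.

Lemma normr_Im_le z : `|complex.Im z| <= cabs z.
Proof.
by rewrite -ler_sqr ?nnegrE ?cabs_ge0// sqr_cabs real_normK ?num_real// lerDr
  sqr_ge0.
Qed.

Lemma cabs_le_ReIm z : cabs z <= `|complex.Re z| + `|complex.Im z|.
Proof.
rewrite -ler_sqr ?nnegrE ?cabs_ge0 ?addr_ge0// sqr_cabs sqrrD !real_normK
  ?num_real//.
by rewrite -addrA addrCA lerDr// addrC; nra.
Qed.

Lemma cabs_box (p q : R * R) (d : R) : `|q.1 - p.1| < d / 2 -> `|q.2 - p.2| < d / 2 ->
  cabs (q.1 +i* q.2 - (p.1 +i* p.2)) < d.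
Proof.
move=> q1 q2; apply: le_lt_trans (cabs_le_ReIm _) _.
by rewrite [d]splitr ltrD.
Qed.

Lemma cabs_normC z : `|z| = (cabs z)%:C.
Proof. by rewrite normc_def; case: z. Qed.

End Modulus.

(** * Derivatives along real lines *)

(** Stated over an arbitrary number field, so that it serves both for real functions of a
    real variable and for complex functions of a complex variable. *)
Lemma derivable1_expansion (K : numFieldType) (f : K^o -> K^o) (z : K^o) :
  derivable f z 1 -> forall e : K, 0 < e -> exists2 d : K, 0 < d &
    forall s : K, `|s| < d -> `|f (z + s) - f z - s * 'D_1 f z| <= e * `|s|.
Proof.
move=> df e e0; set l := 'D_1 f z.
have /cvgrPdist_le/(_ _ e0) := df.
rewrite -/(derive _ _ _) -/l => /nbhs_normP[d /= d0 hd].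
exists d => // s sd.
have [->|s0] := eqVneq s 0.
  by rewrite mul0r addr0 !subrr normr0 mulr0.
have sb : ball_ Num.norm 0 d s by rewrite /ball_ /= sub0r normrN.
move: (hd s sb s0); set q := l - _ => hq.
have -> : f (z + s) - f z - s * l = - (s * q).
  rewrite /q mulrBr -[_ *: (_ - _)]/(_ * _) mulVKf//.
  rewrite [_%:A](_ : _ = s); last by rewrite -[LHS]/(_ * _) mulr1.
  by rewrite opprB [z + _]addrC.
by rewrite normrN normrM mulrC ler_wpM2r.
Qed.

(** The direction is an arbitrary complex number rather than an angle, so that [L] is
    real-linear in [u] for a differentiable [F]. *)
Definition is_line_derivative {R : realType} (F : R[i] -> R[i]) (z u L : R[i]) :=
  forall e : R, 0 < e -> exists2 d : R, 0 < d &
    forall t : R, `|t| < d -> cabs (F (z + t%:C * u) - F z - t%:C * L) <= e * `|t|.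

Section LineDerivative.
Variable R : realType.
Implicit Types (F H : R[i] -> R[i]) (z u L : R[i]).

Lemma line_derivativeB F H z u L L' :
  is_line_derivative F z u L -> is_line_derivative H z u L' ->
  is_line_derivative (fun w => F w - H w) z u (L - L').
Proof.
move=> dF dH e e0.
have e20 : 0 < e / 2 by rewrite divr_gt0.
have [d1 d10 hF] := dF _ e20; have [d2 d20 hH] := dH _ e20.
exists (Num.min d1 d2); first by rewrite lt_min d10.
move=> t; rewrite lt_min => /andP[t1 t2].
rewrite (_ : _ - _ = (F (z + t%:C * u) - F z - t%:C * L) -
                     (H (z + t%:C * u) - H z - t%:C * L')); last by ring.
apply: (le_trans (cabsB _ _)); apply: (le_trans (lerD (hF t t1) (hH t t2))).
by rewrite -mulrDl -splitr.
Qed.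

Lemma line_derivative_conj F z u L :
  is_line_derivative F z u L ->
  is_line_derivative (fun w => conjc (F w)) z u (conjc L).
Proof.
move=> dF e /dF[d d0 h]; exists d => // t /h; rewrite -[X in X <= _]cabs_conj.
by rewrite !rmorphB rmorphM /= oppr0.
Qed.

Lemma line_derivative_id z u : is_line_derivative id z u u.
Proof.
move=> e e0; exists 1 => // t _.
by rewrite [z + _]addrC addrK subrr cabs0 mulr_ge0// ltW.
Qed.

(** Both difference quotients converge, so a Lipschitz domination of increments passes to
    the limit. *)
Lemma line_derivative_le F H z u L L' (C d : R) :
  0 <= C -> 0 < d ->
  is_line_derivative F z u L -> is_line_derivative H z u L' ->
  (forall t : R, `|t| < d ->
    cabs (F (z + t%:C * u) - F z) <= C * cabs (H (z + t%:C * u) - H z)) ->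
  cabs L <= C * cabs L'.
Proof.
move=> C0 d0 dF dH FH; apply/ler_addgt0Pr => e e0.
have C10 : 0 < 1 + C by rewrite ltr_pwDl.
have e10 : 0 < e / (1 + C) by rewrite divr_gt0.
have [d1 d10 hF] := dF _ e10; have [d2 d20 hH] := dH _ e10.
pose t := Num.min d (Num.min d1 d2) / 2.
have t0 : 0 < t by rewrite divr_gt0// !lt_min d0 d10.
have tm : t < Num.min d (Num.min d1 d2).
  by rewrite ltr_pdivrMr// ltr_pMr ?ltr1n// !lt_min d0 d10.
have tE : `|t| = t by rewrite gtr0_norm.
move: tm; rewrite !lt_min -{1 2 3}tE => /and3P[/FH ht /hF hFt /hH hHt].
move: ht hFt hHt; rewrite tE.
set f := F _ - F z; set h := H _ - H z => ht hFt hHt.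
have FL : t * cabs L <= cabs f + e / (1 + C) * t.
  rewrite -[X in X * cabs L]gtr0_norm// -cabs_real -cabsM.
  rewrite (_ : t%:C * L = f - (f - t%:C * L)); last by ring.
  by rewrite (le_trans (cabsB _ _))// lerD2l.
have HL : cabs h <= t * cabs L' + e / (1 + C) * t.
  rewrite -[X in X * cabs L']gtr0_norm// -cabs_real -cabsM.
  rewrite {1}(_ : h = t%:C * L' + (h - t%:C * L')); last by ring.
  by rewrite (le_trans (cabsD _ _))// lerD2l.
have HL' := ler_wpM2l C0 HL.
rewrite -(ler_pM2l t0).
have -> : t * (C * cabs L' + e) = C * (t * cabs L' + e / (1 + C) * t) + e / (1 + C) * t.
  by field; rewrite gt_eqF.
lra.
Qed.

End LineDerivative.

Section LineDerivativeInstances.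
Variable R : realType.
Implicit Types (F : R[i] -> R[i]) (z u : R[i]).

Lemma line_derivative_analytic F z u :
  derivable (F : R[i]^o -> R[i]^o) z 1 ->
  is_line_derivative F z u (u * derive (F : R[i]^o -> R[i]^o) z 1).
Proof.
move=> dF e e0.
have cu0 : 0 < 1 + cabs u by rewrite ltr_pwDl ?cabs_ge0.
have eu0C : 0 < (e / (1 + cabs u))%:C :> R[i] by rewrite ltcR divr_gt0.
have [[d d']] := derivable1_expansion dF eu0C.
rewrite ltcE /= => /andP[/eqP -> d0] hd.
exists (d / (1 + cabs u)); first by rewrite divr_gt0.
move=> t; rewrite ltr_pdivlMr// => td.
have tu : cabs (t%:C * u) <= `|t| * (1 + cabs u).
  by rewrite cabsM cabs_real ler_wpM2l// lerDr.
have := hd (t%:C * u); rewrite !cabs_normC ltcR (le_lt_trans tu)// => /(_ isT).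
rewrite -rmorphM /= lecR mulrA => /le_trans; apply.
rewrite -mulrA ler_pM2l//.
by rewrite ler_pdivrMl// [leRHS]mulrC.
Qed.

(** The increment [s] may be negative. *)
Lemma mean_value (f df : R -> R) (x s d : R) : `|s| < d ->
  (forall a, `|a - x| < d -> is_derive a 1 f (df a)) ->
  exists2 c, `|c - x| <= `|s| & f (x + s) - f x = s * df c.
Proof.
move=> sd hf.
have near w : w \in `[Num.min x (x + s), Num.max x (x + s)] -> `|w - x| <= `|s|.
  rewrite in_itv /= ler_norml.
  have s1 := ler_norm s; have s2 := ler_norm (- s); rewrite normrN in s2.
  by case: (leP x (x + s)) => ? /andP[? ?]; apply/andP; split; lra.
have cont : {within `[Num.min x (x + s), Num.max x (x + s)], continuous f}.
  apply: derivable_within_continuous => w /near ws.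
  by apply: (@ex_derive _ _ _ _ _ _ _ (hf w _)); exact: le_lt_trans sd.
have der w : w \in `]Num.min x (x + s), Num.max x (x + s)[ -> is_derive w 1 f (df w).
  by move=> /subset_itv_oo_cc/near ws; apply: hf; exact: le_lt_trans sd.
have mM : Num.min x (x + s) <= Num.max x (x + s) by rewrite ge_min !le_max lexx.
have [c /near cs H] := MVT_segment mM der cont.
exists c => //.
by move: H; case: (leP x (x + s)) => _ ?; lra.
Qed.

(** Continuity of one of the two partial derivatives is what makes the mean value theorem
    give an expansion to first order. *)
Lemma two_variable_expansion (phi phix : R -> R -> R) (x y b d0 : R) :
  0 < d0 ->
  (forall a, forall c, `|a - x| < d0 -> `|c - y| < d0 ->
     is_derive a 1 (phi ^~ c) (phix a c)) ->
  is_derive y 1 (phi x) b ->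
  (forall e, 0 < e -> exists2 d, 0 < d & forall a c,
     `|a - x| < d -> `|c - y| < d -> `|phix a c - phix x y| <= e) ->
  forall e, 0 < e -> exists2 d, 0 < d & forall s r, `|s| < d -> `|r| < d ->
    `|phi (x + s) (y + r) - phi x y - (s * phix x y + r * b)|
      <= e * (`|s| + `|r|).
Proof.
move=> d00 hx hy cx e e0.
have [d1 d10 h1] := cx _ e0.
have [d2 d20 h2] := derivable1_expansion (@ex_derive _ _ _ _ _ _ _ hy) e0.
exists (Num.min d0 (Num.min d1 d2)); first by rewrite !lt_min d00 d10.
move=> s r; rewrite !lt_min => /and3P[s0 s1 _] /and3P[r0 r1 r2].
have yr m : `|r| < m -> `|y + r - y| < m by rewrite [y + r]addrC addrK.
have [c cs Ec] := mean_value s0 (fun a ha => hx a _ ha (yr _ r0)).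
rewrite (_ : _ - _ = s * (phix c (y + r) - phix x y) +
   (phi x (y + r) - phi x y - r * b)); last first.
  by rewrite mulrBr -Ec; ring.
rewrite [leRHS]mulrDr; apply: (le_trans (ler_normD _ _)); apply: lerD.
  rewrite normrM mulrC ler_wpM2r// h1//; first exact: le_lt_trans s1.
  exact: yr.
by have := h2 _ r2; rewrite (@derive_val _ _ _ _ _ _ _ hy).
Qed.

Lemma continuous_onP (D : set R[i]) F : continuous_on D F ->
  forall z, D z -> forall e : R, 0 < e -> exists2 d : R, 0 < d &
    forall w, D w -> cabs (w - z) < d -> cabs (F w - F z) <= e.
Proof.
move=> /subspace_continuousP cF z Dz e e0.
have eC : 0 < e%:C :> R[i] by rewrite ltcR.
have /cvgrPdist_le/(_ _ eC)/nbhs_normP[[d d']] := cF z Dz.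
rewrite /= ltcE /= => /andP[/eqP -> d0] hd; exists d => // w Dw wz.
have /hd/(_ Dw) : ball_ Num.norm z (d +i* 0) w.
  by rewrite /ball_ /= cabs_normC ltcR cabsBC.
by rewrite cabs_normC lecR cabsBC.
Qed.

Lemma disk_nbhs z : disk z -> exists2 d : R, 0 < d &
  forall w, cabs (w - z) < d -> disk w.
Proof.
rewrite /disk /= => z1; exists (1 - cabs z); first by rewrite subr_gt0.
move=> w wz; rewrite -(subrK z w) (le_lt_trans (cabsD _ _))//.
by rewrite -ltrBrDr.
Qed.

Lemma disk_nbhs_line z u : disk z -> exists2 d : R, 0 < d &
  forall t : R, `|t| < d -> disk (z + t%:C * u).
Proof.
move=> /disk_nbhs[d d0 hd].
have u1 : 0 < 1 + cabs u by rewrite ltr_pwDl ?cabs_ge0.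
exists (d / (1 + cabs u)); first by rewrite divr_gt0.
move=> t; rewrite ltr_pdivlMr// => td; apply: hd.
rewrite [z + _]addrC addrK cabsM cabs_real; apply: le_lt_trans td.
by rewrite ler_wpM2l// lerDr.
Qed.

Lemma line_derivative_C1 F z u : Cm 1 (@disk R) F -> disk z ->
  is_line_derivative F z u
    ((complex.Re u)%:C * dx F z + (complex.Im u)%:C * dy F z).
Proof.
move=> [_ [dF [[cFx _] _]]] Dz e e0.
case: u => p q /=.
have [d0 d00 hD] := disk_nbhs Dz.
move: z Dz hD => [x y] Dz hD.
have d02 : 0 < d0 / 2 by rewrite divr_gt0.
have box m a c : `|a - x| < m / 2 -> `|c - y| < m / 2 ->
    cabs (a +i* c - (x +i* y)) < m.
  exact: (@cabs_box R (x, y) (a, c)).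
have pq0 : 0 < 1 + `|p| + `|q| by rewrite -addrA ltr_pwDl// addr_ge0.
have e1 : 0 < e / 2 / (1 + `|p| + `|q|) by rewrite !divr_gt0.
have cx e' : 0 < e' -> exists2 d : R, 0 < d & forall a c,
    `|a - x| < d -> `|c - y| < d -> cabs (dx F (a +i* c) - dx F (x +i* y)) <= e'.
  move=> /(continuous_onP cFx Dz)[d d_gt0 hd].
  exists (Num.min d0 d / 2); first by rewrite divr_gt0// lt_min d00.
  move=> a c ax cy; have := box _ _ _ ax cy.
  by rewrite lt_min => /andP[/hD/hd].
(* The real and the imaginary part of [F] are expanded separately, [pr] being either. *)
have expand (pr : R[i] -> R) : {morph pr : a b / a - b} ->
    (forall w, `|pr w| <= cabs w) ->
    (forall c t, cderivable c t -> is_derive t 1 (pr \o c) (pr (cderive c t))) ->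
    exists2 d, 0 < d & forall s r, `|s| < d -> `|r| < d ->
      `|pr (F ((x + s) +i* (y + r))) - pr (F (x +i* y)) -
        (s * pr (dx F (x +i* y)) + r * pr (dy F (x +i* y)))|
        <= e / 2 / (1 + `|p| + `|q|) * (`|s| + `|r|).
  move=> prB pr_le prD.
  apply: (two_variable_expansion (phi := fun a c => pr (F (a +i* c)))
    (phix := fun a c => pr (dx F (a +i* c))) d02) => //.
  - move=> a c ax cy; apply: prD; exact: (dF _ (hD _ (box _ _ _ ax cy))).1.
  - exact/prD/(dF _ Dz).2.
  - move=> e' /cx[d ? hd]; exists d => // a c ax cy.
    by rewrite -prB (le_trans (pr_le _))// hd.
have [||d1 d10 h1] := expand (@complex.Re R) _ (@normr_Re_le _).
- by move=> [? ?] [? ?].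
- by move=> c t [h _]; rewrite /= derive1E; exact: derivableP.
have [||d2 d20 h2] := expand (@complex.Im R) _ (@normr_Im_le _).
- by move=> [? ?] [? ?].
- by move=> c t [_ h]; rewrite /= derive1E; exact: derivableP.
exists (Num.min d1 d2 / (1 + `|p| + `|q|)).
  by rewrite divr_gt0// lt_min d10.
move=> t; rewrite ltr_pdivlMr// lt_min => /andP[t1 t2].
have tp : `|t * p| <= `|t| * (1 + `|p| + `|q|).
  by rewrite normrM ler_wpM2l// addrAC lerDr addr_ge0.
have tq : `|t * q| <= `|t| * (1 + `|p| + `|q|).
  by rewrite normrM ler_wpM2l// lerDr addr_ge0.
have := h1 _ _ (le_lt_trans tp t1) (le_lt_trans tq t1).
have := h2 _ _ (le_lt_trans tp t2) (le_lt_trans tq t2).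
have -> : x +i* y + t%:C * (p +i* q) = (x + t * p) +i* (y + t * q).
  by apply/eqP; rewrite eq_complex /= !mul0r subr0 addr0 !eqxx.
move: (F _) (F _) (dx F _) (dy F _) => [a1 a2] [b1 b2] [c1 c2] [f1 f2].
move=> H2 H1; rewrite /= in H1 H2; apply: (le_trans (cabs_le_ReIm _)).
rewrite /= !mul0r !subr0 !addr0.
have tpq : e / 2 / (1 + `|p| + `|q|) * (`|t * p| + `|t * q|) <= e / 2 * `|t|.
  rewrite -[leLHS]mulrA ler_pM2l ?divr_gt0// ler_pdivrMl// !normrM.
  by rewrite -mulrDr mulrC ler_wpM2r// -addrA lerDr.
apply: (@le_trans _ _ (e / 2 * `|t| + e / 2 * `|t|)); last by rewrite -mulrDl -splitr.
apply: lerD; apply: le_trans tpq; [apply: le_trans H1|apply: le_trans H2];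
  rewrite le_eqVlt; apply/orP; left; apply/eqP; congr `|_|; ring.
Qed.
End LineDerivativeInstances.

Local Notation plane R := (measurableTypeR R * measurableTypeR R)%type.

(** * Continuous functions on the plane: measurability and boundedness *)

Section PlaneMeasurability.
Variable R : realType.

(** The plane carries the product of two Borel structures, so openness enters through
    squares: an open set is the union of the countably many squares with rational centre
    and radius [n.+1^-1] that it contains. *)
Lemma measurable_plane_open (U : set (plane R)) :
  (forall p, U p -> exists2 e : R, 0 < e &
    forall q : plane R, `|q.1 - p.1| < e -> `|q.2 - p.2| < e -> U q) ->
  measurable U.
Proof.
move=> oU.
pose itv (a : rat) (n : nat) := `](ratr a - n.+1%:R^-1 : R), (ratr a + n.+1%:R^-1)[%classic.
pose box (i : rat * rat * nat) : set (plane R) := itv i.1.1 i.2 `*` itv i.1.2 i.2.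
pose F i := if `[< box i `<=` U >] then box i else set0.
rewrite (_ : U = \bigcup_i F i); last first.
  apply/seteqP; split => [p Up|p [i _]]; last by rewrite /F; case: asboolP => // h /h.
  have [e e0 he] := oU _ Up.
  have [n /= n1] : exists n, n.+1%:R^-1 < e / 2.
    have e2 : 0 < e / 2 by rewrite divr_gt0.
    have := archi_boundP (ltW (_ : 0 < (e / 2)^-1)); rewrite invr_gt0 => /(_ e2) h.
    exists (Num.bound (e / 2)^-1).
    rewrite invf_plt ?posrE// (lt_trans h)// ltr_nat.
    by [].
  have close (x : R) : exists a : rat, itv a n x.
    have [|a] := @rat_in_itvoo R (x - n.+1%:R^-1) (x + n.+1%:R^-1).
      by rewrite ltrBlDr -addrA ltrDl addr_gt0.
    rewrite in_itv /= => ax; exists a; rewrite /itv /= in_itv /=.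
    by move: (ratr a : R) (n.+1%:R^-1 : R) ax => m r /andP[? ?]; apply/andP; split; lra.
  have [a pa] := close p.1; have [b pb] := close p.2.
  exists (a, b, n) => //; rewrite /F asboolT//.
  have near c x y : itv c n x -> itv c n y -> `|x - y| < e.
    rewrite /itv /= !in_itv /=.
    move: (ratr c : R) (n.+1%:R^-1 : R) n1 => m r ? /andP[? ?] /andP[? ?].
    by rewrite ltr_norml; apply/andP; split; lra.
  by move=> q [qa qb]; apply: he; [exact: near qa pa|exact: near qb pb].
apply: countable_bigcupT_measurable; first exact: countableP.
move=> i; rewrite /F; case: ifP => // _.
by apply: measurableX; exact: measurable_itv.
Qed.

Lemma measurable_fun_plane (D : set (plane R)) (u : plane R -> R) :
  (forall p, D p -> exists2 e : R, 0 < e &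
    forall q : plane R, `|q.1 - p.1| < e -> `|q.2 - p.2| < e -> D q) ->
  (forall p, D p -> forall e : R, 0 < e -> exists2 d : R, 0 < d &
    forall q : plane R, D q -> `|q.1 - p.1| < d -> `|q.2 - p.2| < d -> `|u q - u p| <= e) ->
  measurable_fun D u.
Proof.
move=> oD cu mD; apply: (measurability _ (RGenOInfty.measurableE R)) => //.
move=> _ [_ [a ->] <-]; apply: measurable_plane_open => p [Dp].
rewrite /= in_itv /= andbT => ap.
have [e e0 he] := oD _ Dp.
have up0 : 0 < (u p - a) / 2 by rewrite divr_gt0// subr_gt0.
have [d d0 hd] := cu _ Dp _ up0.
exists (Num.min e d); first by rewrite lt_min e0.
move=> q; rewrite !lt_min => /andP[q1 q2] /andP[q3 q4].
have Dq := he _ q1 q3; split => //; rewrite /= in_itv /= andbT.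
have := hd _ Dq q2 q4; rewrite ler_norml => /andP[? _]; lra.
Qed.

Lemma measurable_disk : measurable [set p : plane R | disk (p.1 +i* p.2)].
Proof.
apply: measurable_plane_open => p /= /disk_nbhs[d d0 hd].
exists (d / 2); first by rewrite divr_gt0.
by move=> q q1 q2; apply: hd; exact: cabs_box.
Qed.

(** The covering argument runs over the compact square $[-1,1]^2$; off the closed disk the
    bound is vacuous, and stays so on a neighbourhood. *)
Lemma continuous_cdisk_bounded (g : R[i] -> R[i]) : continuous_on (@cdisk R) g ->
  exists2 M : R, 0 < M & forall z, cdisk z -> cabs (g z) <= M.
Proof.
move=> cg.
have cK : compact (`[(-1 : R), 1] `*` `[(-1 : R), 1]).
  by apply: compact_setX; exact: segment_compact.
move/compact_near_coveringP : cK.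
move=> /(_ _ (pinfty_nbhs R) (fun M p => cdisk (p.1 +i* p.2) -> cabs (g (p.1 +i* p.2)) <= M)).
have nearbox (p : R * R) (d : R) : 0 < d -> \forall q \near p,
    cabs (q.1 +i* q.2 - (p.1 +i* p.2)) < d.
  move=> d0.
  have d2 : 0 < d / 2 by rewrite divr_gt0.
  exists (ball p.1 (d / 2), ball p.2 (d / 2)); first by split; exact: nbhsx_ballx.
  move=> q [/= q1 q2]; apply: cabs_box; rewrite distrC.
  exact: q1. exact: q2.
case.
  move=> p _.
  have [Dp|Dp] := pselect (cdisk (p.1 +i* p.2)).
    have [d d0 hd] := continuous_onP cg Dp ltr01.
    near=> q M => /= Dq.
    have : cabs (g (q.1 +i* q.2) - g (p.1 +i* p.2)) <= 1.
      by apply: hd => //; near: q; exact: nearbox.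
    have Mp : cabs (g (p.1 +i* p.2)) + 1 <= M.
      by near: M; apply: nbhs_pinfty_ge; exact: num_real.
    move=> h; apply: le_trans Mp.
    rewrite -(subrK (g (p.1 +i* p.2)) (g (q.1 +i* q.2))).
    by rewrite (le_trans (cabsD _ _))// addrC lerD2l.
  move: Dp; rewrite /cdisk /= => /negP; rewrite -ltNge -subr_gt0 => Dp.
  near=> q M => /= Dq; exfalso.
  have : cabs (q.1 +i* q.2 - (p.1 +i* p.2)) < cabs (p.1 +i* p.2) - 1.
    by near: q; exact: nearbox.
  rewrite cabsBC ltrBrDr => h.
  have {}Dq : cabs (q.1 +i* q.2) <= 1 by [].
  have := cabsD (p.1 +i* p.2 - (q.1 +i* q.2)) (q.1 +i* q.2).
  by rewrite subrK leNgt (le_lt_trans (lerD (lexx _) Dq)).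
move=> M [Mr hM].
exists (Num.max M 0 + 1); first by rewrite ltr_pwDr// le_max lexx orbT.
move=> [x y] Dz; have z1 : cabs (x +i* y) <= 1 by [].
apply: (hM _ _ (x, y)) => //=.
  by rewrite ltr_pwDr// le_max lexx.
have hx := le_trans (normr_Re_le _) z1; have hy := le_trans (normr_Im_le _) z1.
by split; rewrite /= in_itv /= -ler_norml.
Unshelve. all: by end_near.
Qed.

End PlaneMeasurability.

(** * A majorant of 1/|z - w| with uniformly bounded integral *)

Section SingularMajorant.
Variable R : realType.
Local Notation area := ((@lebesgue_measure R) \x (@lebesgue_measure R))%E.

Definition square (z : R[i]) (r : R) : set (plane R) :=
  `[complex.Re z - r, complex.Re z + r]%classic `*`
  `[complex.Im z - r, complex.Im z + r]%classic.

(** A dyadic substitute for $w \mapsto 1/|z - w|$: up to constants, $2^n$ is the value of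
    that function on the boundary of the [n]-th square. The sum is infinite at [z] itself,
    so it dominates there whatever value the kernel takes by convention. *)
Definition singular_majorant (z : R[i]) (p : plane R) : \bar R :=
  (\sum_(0 <= n <oo) (2 ^+ n * \1_(square z (2 / 2 ^+ n)) p)%:E)%E.

Lemma measurable_square z r : measurable (square z r).
Proof. by apply: measurableX; exact: measurable_itv. Qed.

Lemma area_square z r : 0 < r -> area (square z r) = ((2 * r) ^+ 2)%:E.
Proof.
move=> r0; rewrite /square product_measure1E; [|exact: measurable_itv..].
rewrite /= !lebesgue_measure_itv /= !lte_fin.
have h (x : R) : x - r < x + r by lra.
rewrite !h -!EFinB -EFinM; congr (_%:E); ring.
Qed.

Lemma majorant_term_ge0 z n p : (0 <= (2 ^+ n * \1_(square z (2 / 2 ^+ n)) p : R)%:E)%E.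
Proof. by rewrite lee_fin mulr_ge0// exprn_ge0. Qed.

Lemma measurable_majorant_term z n (D : set (plane R)) : measurable_fun D
  (fun p => (2 ^+ n * \1_(square z (2 / 2 ^+ n)) p : R)%:E).
Proof.
apply/measurable_EFinP/measurable_funM => //.
by apply: measurable_indic; exact: measurable_square.
Qed.

Lemma singular_majorant_ge0 z p : (0 <= singular_majorant z p)%E.
Proof. by apply: nneseries_ge0 => n _ _; exact: majorant_term_ge0. Qed.

Lemma measurable_singular_majorant z (D : set (plane R)) :
  measurable_fun D (singular_majorant z).
Proof.
apply: ge0_emeasurable_sum => [n p _ _|n _]; first exact: majorant_term_ge0.
exact: measurable_majorant_term.
Qed.

(** The [n]-th term integrates to $2^n (4/2^n)^2$, so the series of integrals is
    geometric, with a sum that does not depend on the singular point. *)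
Lemma integral_singular_majorant z (D : set (plane R)) : measurable D ->
  (\int[area]_(p in D) singular_majorant z p <= 32%:E)%E.
Proof.
move=> mD; apply: (@le_trans _ _ (\int[area]_p singular_majorant z p)%E).
  apply: ge0_subset_integral => //; first exact: measurable_singular_majorant.
  by move=> *; exact: singular_majorant_ge0.
rewrite integral_nneseries//; last first.
  by move=> n; exact: measurable_majorant_term.
rewrite [leLHS](_ : _ = (\sum_(0 <= n <oo) (32 / (2 ^ (n + 1))%:R)%:E)%E).
  have /cvg_lim -> // := @cvg_geometric_eseries_half R 32 0.
  by rewrite expr0 divr1.
apply: eq_eseriesr => n _.
under eq_integral do rewrite EFinM.
have r0 : (0 : R) < 2 / 2 ^+ n by rewrite divr_gt0 ?exprn_gt0.
rewrite ge0_integralZl//; last first.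
  by apply/measurable_EFinP; apply: measurable_indic; exact: measurable_square.
rewrite integral_indic//; last exact: measurable_square.
rewrite setIT [X in (_ * X)%E](area_square z r0) -EFinM; congr (_%:E).
rewrite natrX addn1 [(2 : R) ^+ n.+1]exprS.
have n0 : (2 : R) ^+ n != 0 by rewrite expf_neq0.
by field.
Qed.

Lemma integrable_singular_majorant z (D : set (plane R)) : measurable D ->
  area.-integrable D (singular_majorant z).
Proof.
move=> mD; apply/integrableP; split; first exact: measurable_singular_majorant.
under eq_integral do rewrite gee0_abs ?singular_majorant_ge0//.
exact: le_lt_trans (integral_singular_majorant z mD) (ltry _).
Qed.

(** The square attached to the least [n] with [c <= 2 ^+ n] contains [w]; at [w = z] the
    hypotheses hold for every [c], and the majorant is infinite. *)
Lemma singular_majorant_ge z w (c : R) : cabs (z - w) <= 2 -> c * cabs (z - w) <= 1 ->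
  (c%:E <= singular_majorant z (complex.Re w, complex.Im w))%E.
Proof.
move=> zw2 czw.
have [c0|c0] := leP c 0.
  by apply: le_trans (singular_majorant_ge0 _ _); rewrite lee_fin.
have ex : exists n, c <= 2 ^+ n.
  exists (Num.bound c); apply: ltW; apply: (lt_trans (archi_boundP (ltW c0))).
  by rewrite -natrX ltr_nat ltn_expl.
case: (ex_minnP ex) => n cn nmin.
have rho : cabs (z - w) <= 2 / 2 ^+ n.
  case: n cn nmin => [|m] cn nmin; first by rewrite expr0 divr1.
  have mc : 2 ^+ m < c.
    by rewrite ltNge; apply/negP => /nmin; rewrite ltnn.
  rewrite exprS invfM mulrA divff// mul1r.
  have m0 : (0 : R) < 2 ^+ m by rewrite exprn_gt0.
  rewrite -[leRHS]mul1r ler_pdivlMr//; apply: le_trans czw.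
  by rewrite mulrC ler_wpM2r ?cabs_ge0// ltW.
apply: le_trans (nneseries_lim_ge n.+1 _); last by move=> *; exact: majorant_term_ge0.
rewrite big_nat_recr//=; apply: (@le_trans _ _ (2 ^+ n)%:E); first by rewrite lee_fin.
rewrite (_ : \1_(_) _ = 1 :> R) ?mulr1.
  by rewrite leeDr// sume_ge0// => *; exact: majorant_term_ge0.
rewrite indicE mem_set//.
move: (le_trans (normr_Re_le _) rho) (le_trans (normr_Im_le _) rho).
rewrite !raddfB /= !ler_norml => /andP[? ?] /andP[? ?].
by split; rewrite /= in_itv /=; apply/andP; split; lra.
Qed.

End SingularMajorant.

(** * The Green potential is Lipschitz on the disk *)

Section GreenPotential.
Variable R : realType.
Local Notation area := ((@lebesgue_measure R) \x (@lebesgue_measure R))%E.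
Implicit Types (z w : R[i]) (p : plane R).

Definition point (p : plane R) : R[i] := p.1 +i* p.2.

Definition green_kernel z p : R :=
  ln (cabs ((1 - z * conjc (point p)) / (z - point p))).

(** The difference of the squares is $(1 - |z|^2)(1 - |w|^2)$. *)
Lemma cabs_sub_le_reflection z w : disk z -> disk w ->
  cabs (z - w) <= cabs (1 - z * conjc w).
Proof.
rewrite /disk /= => z1 w1.
have sq1 (v : R[i]) : cabs v < 1 -> 0 <= 1 - cabs v ^+ 2.
  by move=> v1; rewrite subr_ge0 expr_le1 ?cabs_ge0// ltW.
rewrite -ler_sqr ?nnegrE ?cabs_ge0// -subr_ge0.
have := mulr_ge0 (sq1 _ z1) (sq1 _ w1).
congr (0 <= _); rewrite !sqr_cabs.
case: z w {z1 w1} => [a b] [c d] /=.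
by ring.
Qed.

(** Both signs follow from $\ln (1 + x) \le x$, applied to $a/b$ and to $b/a$. *)
Lemma ln_sub_le (a b : R) : 0 < a -> 0 < b ->
  `|ln a - ln b| <= `|a - b| * (a^-1 + b^-1).
Proof.
have h (x y : R) : 0 < x -> 0 < y -> ln x - ln y <= `|x - y| * (x^-1 + y^-1).
  move=> x0 y0; rewrite -ln_div ?posrE//.
  have xy : -1 < x / y - 1 by rewrite ltrBrDr addNr divr_gt0.
  have := le_ln1Dx xy; rewrite [1 + _]addrC subrK => /le_trans; apply.
  apply: (@le_trans _ _ (`|x - y| * y^-1)).
    rewrite -[X in _ - X](divff (lt0r_neq0 y0)) -mulrBl.
    by rewrite ler_wpM2r ?ler_norm// invr_ge0 ltW.
  by rewrite ler_wpM2l// lerDr invr_ge0 ltW.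
move=> a0 b0; rewrite ler_norml h// andbT lerNl opprB.
by rewrite distrC addrC [X in _ * X]addrC; have := h b a b0 a0; rewrite [-_ + _]addrC.
Qed.

Lemma cabs_sub_disk z w : disk z -> disk w -> cabs (z - w) <= 2.
Proof.
rewrite /disk /= => z1 w1; apply: (le_trans (cabsB _ _)).
by rewrite (_ : 2 = 1 + 1) ?lerD ?ltW.
Qed.

Lemma cabs_sub_point_gt0 z p : point p != z -> 0 < cabs (z - point p).
Proof.
by move=> pz; rewrite lt_neqAle cabs_ge0 andbT eq_sym cabs_eq0 subr_eq0 eq_sym.
Qed.

Lemma green_kernelE z p : disk z -> disk (point p) -> point p != z ->
  green_kernel z p = ln (cabs (1 - z * conjc (point p))) - ln (cabs (z - point p)).
Proof.
move=> Dz Dp /cabs_sub_point_gt0 pz; rewrite /green_kernel cabsM cabsV ln_div//.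
by rewrite posrE (lt_le_trans pz)// cabs_sub_le_reflection.
Qed.

(** The value comes from the conventions $x / 0 = 0$ and $\ln 0 = 0$. *)
Lemma green_kernel_diag z p : point p = z -> green_kernel z p = 0.
Proof. by rewrite /green_kernel => ->; rewrite subrr invr0 mulr0 cabs0 ln0. Qed.

(** On the disk the quotient is at least 1, so its logarithm lies between 0 and the
    quotient itself, which is at most $2 / |z - w|$. *)
Lemma green_kernel_le z p : disk z -> disk (point p) ->
  (`|green_kernel z p|%:E <= 2%:E * singular_majorant z p)%E.
Proof.
move=> Dz Dp.
have half : ((`|green_kernel z p| / 2)%:E <= singular_majorant z p)%E.
  rewrite [p]surjective_pairing; apply: (@singular_majorant_ge _ z (point p)).
    exact: cabs_sub_disk.
  rewrite -surjective_pairing.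
  have [pz|pz] := eqVneq (point p) z.
    by rewrite green_kernel_diag// normr0 mul0r mul0r.
  have zp0 := cabs_sub_point_gt0 pz.
  have refl := cabs_sub_le_reflection Dz Dp.
  have r1 : 1 <= cabs (1 - z * conjc (point p)) / cabs (z - point p).
    by rewrite ler_pdivlMr// mul1r.
  rewrite /green_kernel cabsM cabsV ger0_norm ?ln_ge0//.
  have := ltW (ln_sublinear (lt_le_trans ltr01 r1)); rewrite ler_pdivlMr// => h.
  rewrite mulrAC ler_pdivrMr// mul1r; apply: (le_trans h).
  apply: (le_trans (cabsB _ _)).
  rewrite cabs1 cabsM cabs_conj (_ : 2 = 1 + 1)// lerD2l.
  move: Dz Dp; rewrite /disk /= => z1 p1.
  by rewrite mulr_ile1 ?cabs_ge0// ltW.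
have := lee_wpmul2l (_ : 0 <= 2%:E)%E half.
rewrite -EFinM mulrCA divff// mulr1; apply.
by rewrite lee_fin.
Qed.

(** Away from the singularities both logarithms vary by at most the displacement divided by
    the distance to the singularity, the reflected term being the smaller one. *)
Lemma green_kernel_sub_le z z' p : disk z -> disk z' -> disk (point p) -> z != z' ->
  (`|green_kernel z p - green_kernel z' p|%:E <=
   (2 * cabs (z - z'))%:E * (singular_majorant z p + singular_majorant z' p))%E.
Proof.
move=> Dz Dz' Dp zz'.
have d0 : 0 < cabs (z - z') by rewrite lt_neqAle cabs_ge0 andbT eq_sym cabs_eq0 subr_eq0.
set c := `|_|.
have d2 : 0 < 2 * cabs (z - z') by rewrite mulr_gt0.
have maj v (e : R) : disk v -> e * cabs (v - point p) <= 1 ->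
    (e%:E <= singular_majorant v p)%E.
  move=> Dv ev; rewrite [p]surjective_pairing.
  by apply: (@singular_majorant_ge _ v (point p)) => //; exact: cabs_sub_disk.
have main : ((c / (2 * cabs (z - z')))%:E <= singular_majorant z p + singular_majorant z' p)%E.
  have [pz|pz] := eqVneq (point p) z.
    apply: le_trans (leeDl _ (singular_majorant_ge0 _ _)).
    by apply: maj => //; rewrite pz subrr cabs0 mulr0.
  have [pz'|pz'] := eqVneq (point p) z'.
    apply: le_trans (leeDr _ (singular_majorant_ge0 _ _)).
    by apply: maj => //; rewrite pz' subrr cabs0 mulr0.
  have zp := cabs_sub_point_gt0 pz; have zp' := cabs_sub_point_gt0 pz'.
  apply: (@le_trans _ _
    ((cabs (z - point p))^-1%:E + (cabs (z' - point p))^-1%:E)%E); last first.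
    by apply: leeD; apply: maj => //; rewrite mulVf ?gt_eqF.
  rewrite -EFinD lee_fin ler_pdivrMr// /c !green_kernelE//.
  have r1 := cabs_sub_le_reflection Dz Dp; have r2 := cabs_sub_le_reflection Dz' Dp.
  have q1 := lt_le_trans zp r1; have q2 := lt_le_trans zp' r2.
  set A := cabs (1 - _) in r1 q1 *; set A' := cabs (1 - _) in r2 q2 *.
  set B := cabs (z - point p) in zp r1 *; set B' := cabs (z' - point p) in zp' r2 *.
  have lipB : `|B - B'| <= cabs (z - z').
    by apply: (le_trans (cabs_dist _ _)); rewrite opprB addrA subrK.
  have lipA : `|A - A'| <= cabs (z - z').
    apply: (le_trans (cabs_dist _ _)).
    rewrite (_ : _ - _ = (z' - z) * conjc (point p)); last by ring.
    by rewrite cabsM cabs_conj cabsBC ler_piMr ?cabs_ge0// ltW.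
  have iA : A^-1 <= B^-1 by rewrite lef_pV2.
  have iA' : A'^-1 <= B'^-1 by rewrite lef_pV2.
  rewrite (_ : _ - _ - _ = (ln A - ln A') - (ln B - ln B')); last by ring.
  apply: (le_trans (ler_normB _ _)).
  have -> : (B^-1 + B'^-1) * (2 * cabs (z - z')) =
    cabs (z - z') * (B^-1 + B'^-1) + cabs (z - z') * (B^-1 + B'^-1) by ring.
  have s0 : 0 <= B^-1 + B'^-1 by rewrite addr_ge0// invr_ge0 ltW.
  apply: lerD.
    apply: (le_trans (ln_sub_le q1 q2)); apply: ler_pM => //.
      by rewrite addr_ge0// invr_ge0 ltW.
    exact: lerD.
  by apply: (le_trans (ln_sub_le zp zp')); rewrite ler_wpM2r.
have := lee_wpmul2l (_ : 0 <= (2 * cabs (z - z'))%:E)%E main.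
rewrite -EFinM mulrCA divff ?gt_eqF// mulr1; apply.
by rewrite lee_fin ltW.
Qed.

Lemma measurable_cabs (d : measure_display) (T : measurableType d) (D : set T) (a b : T -> R) :
  measurable_fun D a -> measurable_fun D b -> measurable_fun D (fun x => cabs (a x +i* b x)).
Proof.
move=> ma mb.
(* The square root is measurable as a power function. *)
rewrite (_ : (fun _ => _) = (fun x => (a x ^+ 2 + b x ^+ 2) `^ 2^-1)); last first.
  by apply/funext => x; rewrite powR12_sqrt// addr_ge0 ?sqr_ge0.
apply: (measurableT_comp (measurable_powR _)).
by apply: measurable_funD; exact: measurable_funX.
Qed.

Lemma measurable_green_kernel z (D : set (plane R)) : measurable_fun D (green_kernel z).
Proof.
case: z => x y.
(* The inverse is written as a power, which is measurable on the whole line. *)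
rewrite (_ : green_kernel _ = (fun p : plane R =>
  ln (cabs ((1 - (x * p.1 + y * p.2)) +i* (x * p.2 - y * p.1)) *
      cabs ((x - p.1) +i* (y - p.2)) `^ (-1)))); last first.
  apply/funext => p; rewrite /green_kernel cabsM cabsV powR_inv1 ?cabs_ge0//.
  congr (ln (cabs _ / _)).
  by apply/eqP; rewrite eq_complex /=; apply/andP; split; apply/eqP; ring.
have m1 : measurable_fun D (fst : plane R -> R) by exact: measurable_funTS measurable_fst.
have m2 : measurable_fun D (snd : plane R -> R) by exact: measurable_funTS measurable_snd.
apply: (measurableT_comp (@measurable_ln R)); apply: measurable_funM.
  apply: measurable_cabs.
    apply: measurable_funB => //; apply: measurable_funD; exact: measurable_funM.
  by apply: measurable_funB; exact: measurable_funM.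
apply: (measurableT_comp (measurable_powR _)).
by apply: measurable_cabs; exact: measurable_funB.
Qed.


Section RealDensity.
Variables (gamma : plane R -> R) (M : R).
Local Notation D := [set p : plane R | disk (point p)].
Hypotheses (mgamma : measurable_fun D gamma) (M0 : 0 < M).
Hypothesis gammaM : forall p, D p -> `|gamma p| <= M.

Let potential z : R := \int[area]_(p in D) (green_kernel z p * gamma p).

Let measurableD : measurable (D : set (plane R)).
Proof. exact: measurable_disk. Qed.

Let measurable_integrand z : measurable_fun D (fun p => green_kernel z p * gamma p).
Proof. by apply: measurable_funM => //; exact: measurable_green_kernel. Qed.

Lemma integrable_green_kernel z : disk z ->
  area.-integrable D (EFin \o (fun p => green_kernel z p * gamma p)).
Proof.
move=> Dz; apply: (@le_integrable _ _ _ _ _ measurableD _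
    (fun p => (2 * M)%:E * singular_majorant z p)%E).
- exact/measurable_EFinP.
- move=> p Dp /=.
  have M20 : (0 <= (2 * M)%:E)%E by rewrite lee_fin mulr_ge0// ltW.
  rewrite gee0_abs ?mule_ge0 ?singular_majorant_ge0// [2 * M]mulrC EFinM -muleA.
  apply: (@le_trans _ _ (M%:E * `|green_kernel z p|%:E)%E).
    by rewrite -EFinM lee_fin normrM mulrC ler_wpM2r// gammaM.
  by apply: lee_wpmul2l; [rewrite lee_fin ltW|exact: green_kernel_le].
- by apply: integrableZl => //; exact: integrable_singular_majorant.
Qed.

Lemma potential_lipschitz z z' : disk z -> disk z' ->
  `|potential z - potential z'| <= 128 * M * cabs (z - z').
Proof.
move=> Dz Dz'.
have [->|zz'] := eqVneq z z'; first by rewrite !subrr normr0 cabs0 mulr0.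
have iz := integrable_green_kernel Dz; have iz' := integrable_green_kernel Dz'.
rewrite /potential -RintegralB//.
under eq_Rintegral do rewrite -mulrBl.
have int : area.-integrable D
    (EFin \o (fun p => (green_kernel z p - green_kernel z' p) * gamma p)).
  have := integrableB measurableD iz iz'; congr (integrable _ _ _).
  by apply/funext => p /=; rewrite -EFinB mulrBl.
rewrite -lee_fin EFin_normr_Rintegral//.
apply: (le_trans (le_abse_integral _ _ _)) => //.
  exact: measurable_int int.
have S0 p : (0 <= singular_majorant z p + singular_majorant z' p)%E.
  by rewrite adde_ge0// singular_majorant_ge0.
have mS : measurable_fun D (fun p => singular_majorant z p + singular_majorant z' p)%E.
  by apply: emeasurable_funD; exact: measurable_singular_majorant.
have c0 : (0 <= (2 * cabs (z - z') * M)%:E)%E.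
  by rewrite lee_fin !mulr_ge0 ?cabs_ge0// ltW.
apply: (@le_trans _ _ (\int[area]_(p in D) ((2 * cabs (z - z') * M)%:E *
   (singular_majorant z p + singular_majorant z' p)))%E).
  apply: ge0_le_integral => //.
  - by apply: measurableT_comp => //; exact: measurable_int int.
  - exact: measurable_funeM.
  - move=> p Dp /=; rewrite normrM [_ * M]mulrC 2!EFinM -muleA.
    apply: (@le_trans _ _ (M%:E * `|green_kernel z p - green_kernel z' p|%:E)%E).
      by rewrite -!EFinM lee_fin mulrC ler_wpM2r// gammaM.
    by apply: lee_wpmul2l; [rewrite lee_fin ltW|exact: green_kernel_sub_le].
rewrite ge0_integralZl// ge0_integralD//; first last.
- exact: measurable_singular_majorant.
- by move=> *; exact: singular_majorant_ge0.
- exact: measurable_singular_majorant.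
- by move=> *; exact: singular_majorant_ge0.
have -> : (128 * M * cabs (z - z'))%:E = ((2 * cabs (z - z') * M)%:E * (32%:E + 32%:E))%E.
  by rewrite -EFinD -EFinM; congr (_%:E); ring.
by apply: lee_wpmul2l => //; apply: leeD; exact: integral_singular_majorant.
Qed.

End RealDensity.

End GreenPotential.

Section GreenLipschitz.
Variable R : realType.
Local Notation area := ((@lebesgue_measure R) \x (@lebesgue_measure R))%E.
Local Notation D := [set p : plane R | disk (point p)].

Lemma disk_sub_cdisk (z : R[i]) : disk z -> cdisk z.
Proof. exact: ltW. Qed.

Lemma measurable_density (g : R[i] -> R[i]) (pr : R[i] -> R) :
  continuous_on (@cdisk R) g -> {morph pr : a b / a - b} ->
  (forall w, `|pr w| <= cabs w) -> measurable_fun D (fun p => pr (g (point p))).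
Proof.
move=> cg prB pr_le; apply: measurable_fun_plane => p Dp.
  have [d d0 hd] := disk_nbhs Dp.
  exists (d / 2); first by rewrite divr_gt0.
  by move=> q q1 q2; apply: hd; exact: cabs_box.
move=> e e0; have [d d0 hd] := continuous_onP cg (disk_sub_cdisk Dp) e0.
exists (d / 2); first by rewrite divr_gt0.
move=> q Dq q1 q2; rewrite -prB (le_trans (pr_le _))// hd//.
  exact: disk_sub_cdisk.
exact: cabs_box.
Qed.

Lemma greenE (g : R[i] -> R[i]) (z : R[i]) : green g z = ((2 * pi)^-1)%:C *
  ((\int[area]_(p in D) (green_kernel z p * complex.Re (g (point p)))) +i*
   (\int[area]_(p in D) (green_kernel z p * complex.Im (g (point p))))).
Proof.
congr (_ * (_ +i* _)); apply: eq_Rintegral => p _; rewrite /= -/(point p);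
  case: (g _) => a b /=; rewrite mul0r ?subr0 ?addr0 //.
Qed.

(** This is what bounds the gradient of $G[g]$, uniformly up to the circle. *)
Lemma green_lipschitz (g : R[i] -> R[i]) : continuous_on (@cdisk R) g ->
  exists2 N : R, 0 <= N & forall z z', disk z -> disk z' ->
    cabs (green g z - green g z') <= N * cabs (z - z').
Proof.
move=> cg; have [M M0 gM] := continuous_cdisk_bounded cg.
have c0 : 0 <= (2 * pi)^-1 :> R by rewrite invr_ge0 mulr_ge0// pi_ge0.
have lip (pr : R[i] -> R) : {morph pr : a b / a - b} -> (forall w, `|pr w| <= cabs w) ->
    forall z z', disk z -> disk z' ->
    `|\int[area]_(p in D) (green_kernel z p * pr (g (point p))) -
      \int[area]_(p in D) (green_kernel z' p * pr (g (point p)))|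
     <= 128 * M * cabs (z - z').
  move=> prB pr_le z z' Dz Dz'.
  apply: (potential_lipschitz (measurable_density cg prB pr_le) M0) => // p Dp.
  exact/(le_trans (pr_le _))/gM/disk_sub_cdisk.
have K0 : 0 <= 128 * M by rewrite mulr_ge0// ltW.
exists ((2 * pi)^-1 * (128 * M + 128 * M)); first by rewrite mulr_ge0// addr_ge0.
move=> z z' Dz Dz'; rewrite !greenE -mulrBr cabsM cabs_real ger0_norm//.
rewrite -[leRHS]mulrA ler_wpM2l// mulrDl.
apply: (le_trans (cabs_le_ReIm _)); apply: lerD.
  by apply: (lip (@complex.Re R)) => //; [move=> [? ?] [? ?]|exact: normr_Re_le].
by apply: (lip (@complex.Im R)) => //; [move=> [? ?] [? ?]|exact: normr_Im_le].
Qed.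
End GreenLipschitz.

(** * Ellipticity *)

Section Ellipticity.
Variable R : realType.
Implicit Types (f : R[i] -> R[i]) (A B z : R[i]).

Lemma line_derivative_wirtinger f z u : Cm 1 (@disk R) f -> disk z ->
  is_line_derivative f z u (u * dz f z + conjc u * dzbar f z).
Proof.
move=> cf Dz; have := line_derivative_C1 u cf Dz.
congr is_line_derivative; rewrite /dz /dzbar.
move: (dx f z) (dy f z) => X Y.
have -> : conjc u = (complex.Re u)%:C - 'i * (complex.Im u)%:C.
  by case: u => p q; apply/eqP; rewrite eq_complex /=; apply/andP; split; apply/eqP; ring.
rewrite {3}[u]complexE complexiE; move: (complex.Re u)%:C (complex.Im u)%:C => p q.
rewrite [RHS](_ : _ = p * X - 'i ^+ 2 * (q * Y)); last by field.
by rewrite sqrCi mulN1r opprK.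
Qed.

(** If $u^2 = \bar A B$ then $u (u A + \bar u B) = B |A| (|A| + |B|)$: the two terms have
    the same argument. *)
Lemma aligning_direction A B : exists2 u, u != 0 &
  cabs (u * A + conjc u * B) = cabs u * (cabs A + cabs B).
Proof.
have [->|A0] := eqVneq A 0.
  by exists 1; rewrite ?oner_neq0// !mulr0 cabs0 !add0r cabsM cabs_conj.
have [->|B0] := eqVneq B 0.
  by exists 1; rewrite ?oner_neq0// !mulr0 cabs0 !addr0 cabsM.
pose u := sqrtc (conjc A * B).
have u2 : u ^+ 2 = conjc A * B by rewrite sqr_sqrtc.
have u0 : u != 0 by rewrite -(sqrf_eq0 u) u2 mulf_neq0// conjc_eq0.
have sq w : w * conjc w = (cabs w ^+ 2)%:C :> R[i].
  by rewrite -sqr_normc cabs_normC rmorphXn.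
exists u => //.
have cu2 : cabs u ^+ 2 = cabs A * cabs B by rewrite expr2 -cabsM -expr2 u2 cabsM cabs_conj.
have cu0 : 0 < cabs u by rewrite lt_neqAle cabs_ge0 andbT eq_sym cabs_eq0.
apply: (mulfI (lt0r_neq0 cu0)); rewrite -cabsM.
have -> : u * (u * A + conjc u * B) = B * (cabs A * (cabs A + cabs B))%:C.
  rewrite mulrDr !mulrA -expr2 u2 sq cu2 mulrDr rmorphD !rmorphM /=.
  rewrite mulrAC [_^* * A]mulrC sq rmorphXn. ring.
rewrite cabsM cabs_real ger0_norm ?mulr_ge0 ?addr_ge0 ?cabs_ge0//.
rewrite [RHS]mulrA -expr2 cu2; ring.
Qed.

(** The sum [s = a + b] satisfies [2 * s <= C * s + C * (a - b) + 2 * C * N]; multiplying by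
    [s] and absorbing the linear term gives the quadratic inequality. *)
Lemma quadratic_absorption (a b C N : R) : 0 <= a -> 0 <= b -> 1 <= C -> C < 2 ->
  a + b <= C * (a + N) ->
  (a + b) ^+ 2 <= 2 * C / (2 - C) * (a ^+ 2 - b ^+ 2) + (2 * C * N / (2 - C)) ^+ 2.
Proof.
move=> a0 b0 C1 C2 h.
have k0 : 0 < 2 - C by rewrite subr_gt0.
pose t := 2 * C * N / (2 - C); rewrite -/t.
have tE : t * (2 - C) = 2 * C * N by rewrite /t mulfVK// lt0r_neq0.
pose P := C / (2 - C).
have PE : P * (2 - C) = C by rewrite /P mulfVK// lt0r_neq0.
rewrite (_ : 2 * C / (2 - C) = 2 * P); last by rewrite mulrA.
have h1 : a + b <= P * (a - b) + t.
  by rewrite -(ler_pM2r k0) [leRHS]mulrDl tE mulrAC PE; lra.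
have s0 : 0 <= a + b by rewrite addr_ge0.
have := ler_wpM2r s0 h1.
have := sqr_ge0 (a + b - t).
rewrite !sqrrD sqrrN; nra.
Qed.


(** For a holomorphic [H] with derivative [L] all directional derivatives have the same
    modulus $|u| |L|$, so the direction that maximises that of [f] gives the whole norm. *)
Lemma lipschitz_normD_le f (H : R[i] -> R[i]) (C : R) z (L : R[i]) : 0 <= C ->
  Cm 1 (@disk R) f -> disk z ->
  (forall u, is_line_derivative H z u (u * L)) ->
  (forall z1 z2, disk z1 -> disk z2 -> cabs (f z1 - f z2) <= C * cabs (H z1 - H z2)) ->
  normD f z <= C * cabs L.
Proof.
move=> C0 cf Dz dH lip.
have [u u0 uE] := aligning_direction (dz f z) (dzbar f z).
have cu0 : 0 < cabs u by rewrite lt_neqAle cabs_ge0 andbT eq_sym cabs_eq0.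
have [d d0 hd] := disk_nbhs_line u Dz.
have := line_derivative_le C0 d0 (line_derivative_wirtinger u cf Dz) (dH u).
rewrite uE cabsM mulrCA ler_pM2l//; apply.
by move=> t td; apply: lip => //; exact: hd.
Qed.

(** Subtracting [h1 + conjc h2] from [f] leaves a potential with bounded gradient, and
    [conjc h2] does not contribute to the holomorphic derivative. *)
Lemma dz_sub_analytic_le f (h1 h2 G : R[i] -> R[i]) (N : R) z :
  Cm 1 (@disk R) f -> disk z -> 0 <= N ->
  analytic_on (@disk R) h1 -> analytic_on (@disk R) h2 ->
  (forall w, disk w -> f w = h1 w + conjc (h2 w) - G w) ->
  (forall z z', disk z -> disk z' -> cabs (G z - G z') <= N * cabs (z - z')) ->
  cabs (dz f z - derive (h1 : R[i]^o -> R[i]^o) z 1) <= N.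
Proof.
move=> cf Dz N0 an1 an2 fE lipG.
set L1 := derive _ _ _; pose L2 := derive (h2 : R[i]^o -> R[i]^o) z 1.
have bound u : cabs ((complex.Re u)%:C * dx f z + (complex.Im u)%:C * dy f z
    - u * L1 - conjc (u * L2)) <= N * cabs u.
  have [d d0 hd] := disk_nbhs_line u Dz.
  have dF := line_derivativeB (line_derivativeB (line_derivative_C1 u cf Dz)
    (line_derivative_analytic u (an1 _ Dz)))
    (line_derivative_conj (line_derivative_analytic u (an2 _ Dz))).
  apply: (line_derivative_le N0 d0 dF (line_derivative_id z u)) => t /hd Dt.
  rewrite !fE// [X in cabs X](_ : _ = - (G (z + t%:C * u) - G z)); last by ring.
  by rewrite cabsN lipG.
rewrite /dz; move: (dx f z) (dy f z) (L1 : R[i]) (L2 : R[i]) bound => X Y l1 l2 bound.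
have Bx : cabs (X - l1 - conjc l2) <= N.
  rewrite (_ : _ - _ = 1%:C * X + 0%:C * Y - 1 * l1 - conjc (1 * l2)).
    by apply: le_trans (bound 1) _; rewrite (@cabs1 R) mulr1.
  by rewrite rmorph1 rmorph0 !mul1r mul0r addr0.
have By : cabs (Y - 'i * l1 + 'i * conjc l2) <= N.
  rewrite (_ : _ + _ = 0%:C * X + 1%:C * Y - 'i%C * l1 - conjc ('i%C * l2)).
    by apply: le_trans (bound 'i%C) _; rewrite (@cabsi R) mulr1.
  rewrite rmorph1 rmorph0 mul1r mul0r add0r rmorphM /= -complexiE.
  congr (_ + _); rewrite -mulNr; congr (_ * _).
  by apply/eqP; rewrite eq_complex /= opprK oppr0 !eqxx.
rewrite (_ : (X - 'i * Y) / 2 - l1 = ((X - l1 - conjc l2) -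
    'i * (Y - 'i * l1 + 'i * conjc l2)) / 2); last first.
  move: (conjc l2) => c.
  rewrite [RHS](_ : _ = (X - l1 - c - 'i * Y + 'i ^+ 2 * l1 - 'i ^+ 2 * c) / 2); last by field.
  by rewrite sqrCi; field.
rewrite cabsM cabsV (_ : cabs 2 = 2); last first.
  by rewrite (_ : 2 = (2 : R)%:C) ?cabs_real ?normr_nat// rmorph_nat.
rewrite ler_pdivrMr// [leRHS]mulrC mulr_natl mulr2n.
apply: (le_trans (cabsB _ _)); apply: lerD => //.
by rewrite cabsM -complexiE cabsi mul1r.
Qed.

End Ellipticity.

Theorem proposition1p4 (R : realType) (psi g f h1 h2 : R[i] -> R[i])
  (psi_L1 : L1_circle psi)
  (psi_bounded : bounded_circle psi)
  (g_continuous : continuous_on (@cdisk R) g)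
  (f_class : poisson_class g psi f)
  (h1_analytic : analytic_on (@disk R) h1)
  (h2_analytic : analytic_on (@disk R) h2)
  (f_decomposition : forall z, disk z -> f z = h1 z + conjc (h2 z) - green g z)
  (f_lipschitz : exists C3 : R, [/\ 1 <= C3, C3 < 2 &
     forall z1 z2, disk z1 -> disk z2 ->
       cabs (f z1 - f z2) <= C3 * cabs (h1 z1 - h1 z2)]) :
  elliptic_mapping f.
Proof.
have C1f : Cm 1 (@disk R) f.
  by case: f_class => -[cf [df [[cx _] [cy _]]]] _ _ _.
split=> //.
have [C [C1 C2 lipf]] := f_lipschitz.
have C0 : 0 <= C by apply: le_trans C1.
have [N N0 lipG] := green_lipschitz g_continuous.
have k0 : 0 < 2 - C by rewrite subr_gt0.
exists (2 * C / (2 - C)), ((2 * C * N / (2 - C)) ^+ 2); split.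
- by rewrite ler_pdivlMr// mul1r; lra.
- exact: sqr_ge0.
move=> z Dz; apply: quadratic_absorption; rewrite ?cabs_ge0//.
apply: (le_trans (lipschitz_normD_le C0 C1f Dz _ lipf)).
  by move=> u; exact: line_derivative_analytic u (h1_analytic _ Dz).
rewrite ler_wpM2l//.
have := dz_sub_analytic_le C1f Dz N0 h1_analytic h2_analytic f_decomposition lipG.
set L := derive _ _ _ => dL.
rewrite -{1}[L](subKr (dz f z)) (le_trans (cabsB _ _))// lerD2l.
exact: dL.
Qed.
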